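(* Let $m\ge 6$ be a positive integer, and for $\theta\in(\frac{2\pi}{m},\frac{2\pi}{m-1})$ let $K_\theta\in\mathcal{P}(m,3)$ be the cone defined in the context. Then: (i) For every $\theta\in(\frac{2\pi}{m},\frac{2\pi}{m-1})$, the automorphism group of $K_\theta$ consists of scalar matrices only. (ii) For any $\theta_1,\theta_2\in(\frac{2\pi}{m},\frac{2\pi}{m-1})$ with $\theta_1\ne\theta_2$, the cones $K_{\theta_1},K_{\theta_2}$ are not linearly isomorphic.
   Context: $\mathcal{P}(m,3)$ is the set of $3$-dimensional polyhedral cones (closed, pointed convex cones with nonempty interior in $\mathbb{R}^3$ and finitely many extreme rays) with exactly $m$ extreme rays. For $\theta\in(\frac{2\pi}{m},\frac{2\pi}{m-1})$, let $r_\theta$ be the unique positive real root of $g_\theta(t)=\frac{\sin(m-1)\theta}{\sin\theta}t^m-\frac{\sin m\theta}{\sin\theta}t^{m-1}+1$. $K_\theta$ is the polyhedral cone in $\mathbb{R}^3$ generated by the vectors $x_j(\theta)=(r_\theta^{j-1}\cos(j-1)\theta,\ r_\theta^{j-1}\sin(j-1)\theta,\ 1)^T$, $j=1,\ldots,m$. An automorphism of a cone $K$ is an invertible real matrix $P$ with $PK=K$. Cones $K_1,K_2$ are linearly isomorphic if there is a linear isomorphism $P:\operatorname{span}K_2\to\operatorname{span}K_1$ with $PK_2=K_1$. *)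

(* Defs.v *)
From mathcomp Require Import all_boot all_order all_algebra.
From mathcomp Require Import all_classical all_reals all_analysis.

Set Implicit Arguments.
Unset Strict Implicit.
Unset Printing Implicit Defensive.

Import Order.TTheory GRing.Theory Num.Theory.

Local Open Scope classical_set_scope.
Local Open Scope ring_scope.

Definition cone_gen (R : realType) (V : lmodType R) (m : nat) (x : 'I_m -> V) :
    set V :=
  [set v | exists2 c : 'I_m -> R, forall j, 0 <= c j & v = \sum_j c j *: x j].

Definition is_linspan (R : realType) (V : vectType R) (K : set V)
    (U : {vspace V}) : Prop :=
  (forall x, K x -> x \in U) /\
  (forall W : {vspace V}, (forall x, K x -> x \in W) -> (U <= W)%VS).

(* The default value 0 is never used, see linspanP. *)
Definition linspan (R : realType) (V : vectType R) (K : set V) : {vspace V} :=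
  xget 0%VS [set U | is_linspan K U].

Lemma linspanP (R : realType) (V : vectType R) (K : set V) :
  is_linspan K (linspan K).
Proof.
suff: exists U, is_linspan K U by exact: xgetPex.
pose D (n : nat) := `[< exists2 X : seq V,
  forall x, x \in X -> K x & \dim <<X>>%VS = n >].
have D0 : exists n, D n.
  by exists 0%N; apply/asboolP; exists [::]; rewrite ?span_nil ?dimv0.
have DB n : D n -> (n <= \dim {:V})%N.
  by move=> /asboolP[X _ <-]; rewrite dimvS // subvf.
case: (ex_maxnP D0 DB) => n /asboolP[X XK Xn] nmax.
exists <<X>>%VS; split=> [x Kx|W KW]; last first.
  by apply/span_subvP => x /XK /KW.
have XxX : (<<X>> <= <<x :: X>>)%VS by rewrite span_cons addvSr.
have : (\dim <<x :: X>> <= \dim <<X>>)%N.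
  rewrite Xn; apply: nmax; apply/asboolP; exists (x :: X) => // y.
  by rewrite inE => /predU1P[->//|/XK].
rewrite (geq_leqif (dimv_leqif_eq XxX)) => /eqP ->.
by rewrite memv_span // mem_head.
Qed.

Definition cone_isomorphic (R : realType) (V1 V2 : vectType R)
    (K1 : set V1) (K2 : set V2) : Prop :=
  exists2 P : {linear subvs_of (linspan K2) -> subvs_of (linspan K1)},
    bijective P & [set vsval (P y) | y in [set y | K2 (vsval y)]] = K1.

Definition cone_aut (R : realType) (n : nat) (K : set 'cV[R]_n) :
    set 'M[R]_n :=
  [set P | P \in unitmx /\ [set P *m x | x in K] = K].

Definition g_theta (R : realType) (m : nat) (theta t : R) : R :=
  sin (m.-1%:R * theta) / sin theta * t ^+ m
  - sin (m%:R * theta) / sin theta * t ^+ m.-1 + 1.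

(* For 2 pi / m < theta < 2 pi / (m - 1), m >= 6, both nonconstant terms of
   g_theta have negative coefficients, so the positive root exists and is
   unique; the default value 0 is then irrelevant. *)
Definition r_theta (R : realType) (m : nat) (theta : R) : R :=
  xget 0 [set t | 0 < t /\ g_theta m theta t = 0].

(* Rays are indexed from 0: x_theta m theta j is x_(j+1)(theta). *)
Definition x_theta (R : realType) (m : nat) (theta : R) (j : 'I_m) :
    'cV[R]_3 :=
  \col_(i < 3) [:: r_theta m theta ^+ j * cos (j%:R * theta);
                   r_theta m theta ^+ j * sin (j%:R * theta);
                   1]`_i.

Definition K_theta (R : realType) (m : nat) (theta : R) : set 'cV[R]_3 :=
  cone_gen (@x_theta R m theta).

(* Main.v *)
(* Write omega = r exp(i theta). The rays of K_theta are the points omega^j on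
   a logarithmic spiral, and g_theta(r) = 0 says that omega^m lies on the
   segment from 1 to omega. A linear isomorphism between two such cones permutes
   the rays and preserves or reverses their cyclic order, since it multiplies
   the determinants of rays by positive factors and a common sign. To each ray
   attach the cross-ratio of the four lines joining it to its four nearest
   neighbours. It is constant along the spiral, smaller at the rays 0, 1, m-2
   and larger at m-1, so the last ray is fixed; a reflection would then exchange
   the rays 1 and m-3, whose cross-ratios are ordered in the same way for both
   cones. Hence every ray is fixed, and comparing the linear recurrences of the
   two spirals shows that omega is the same and that the map is a scalar. *)
Require Import Defs.
From mathcomp Require Import all_boot all_order all_algebra.
From mathcomp Require Import all_classical all_reals all_analysis.
From mathcomp Require Import ring lra zify.

Import Order.TTheory GRing.Theory Num.Theory.

Local Open Scope classical_set_scope.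
Local Open Scope ring_scope.

Set Implicit Arguments.
Unset Strict Implicit.
Unset Printing Implicit Defensive.

(** * Determinants of three vectors and the cross-ratio of a pencil of lines *)

Lemma sum_ord3 (V : nmodType) (F : 'I_3 -> V) :
  \sum_i F i = F 0 + F 1 + F 2%:R.
Proof.
rewrite !big_ord_recr big_ord0 /= add0r.
by congr (F _ + F _ + F _); apply: val_inj.
Qed.

(** Written out in coordinates so that [ring] can expand it; [det3_cols] identifies it with
    [\det]. *)
Definition det3 (R : pzRingType) (u v w : 'cV[R]_3) : R :=
  u 0 0 * (v 1 0 * w 2%:R 0 - v 2%:R 0 * w 1 0)
  - u 1 0 * (v 0 0 * w 2%:R 0 - v 2%:R 0 * w 0 0)
  + u 2%:R 0 * (v 0 0 * w 1 0 - v 1 0 * w 0 0).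

Section Det3.
Variable R : fieldType.
Implicit Types (u v w e f g h k : 'cV[R]_3) (M : 'M[R]_3).

Lemma det3_mulmx M u v w :
  det3 (M *m u) (M *m v) (M *m w) =
  det3 (col 0 M) (col 1 M) (col 2%:R M) * det3 u v w.
Proof. by rewrite /det3 !mxE !sum_ord3; ring. Qed.

Lemma det3_cols_neq0 M : M \in unitmx ->
  det3 (col 0 M) (col 1 M) (col 2%:R M) != 0.
Proof.
move=> Mu; apply/eqP => M0.
have := det3_mulmx M (invmx M *m delta_mx 0 0) (invmx M *m delta_mx 1 0)
  (invmx M *m delta_mx 2%:R 0).
rewrite M0 mul0r !mulKVmx // /det3 !mxE /= => /eqP.
by rewrite !(mulr0, mul0r, subr0, mulr1, addr0) oner_eq0.
Qed.

Lemma det3_rot u v w : det3 u v w = det3 v w u.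
Proof. by rewrite /det3; ring. Qed.

Lemma det3_swapr u v w : det3 u v w = - det3 u w v.
Proof. by rewrite /det3; ring. Qed.

Lemma det3_sumr u v (I : finType) (c : I -> R) (w : I -> 'cV[R]_3) :
  det3 u v (\sum_i c i *: w i) = \sum_i c i * det3 u v (w i).
Proof.
elim/big_ind2 : _ => [|w1 s1 w2 s2 <- <-|i _]; rewrite /det3 !mxE; ring.
Qed.

Lemma det3_scale a b c u v w :
  det3 (a *: u) (b *: v) (c *: w) = a * b * c * det3 u v w.
Proof. by rewrite /det3 !mxE; ring. Qed.

Lemma cramer u v w t :
  det3 u v w *: t =
  det3 t v w *: u + det3 u t w *: v + det3 u v t *: w.
Proof.
apply/matrixP => i j; rewrite ord1 /det3 !mxE.
case: i => -[|[|[|]]] // hi.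
- have -> : Ordinal hi = 0 by exact: val_inj.
  ring.
- have -> : Ordinal hi = 1 by exact: val_inj.
  ring.
- have -> : Ordinal hi = 2%:R by exact: val_inj.
  ring.
Qed.

(* The cross-ratio of the lines joining the third point to the other four. *)
Definition pencil_cr e f g h k : R :=
  det3 g e f * det3 g h k / (det3 g e h * det3 g f k).

(** Reversal changes two signs in the numerator and two in the denominator. This is why cross-ratios
    survive a reflection of the polygon. *)
Lemma pencil_cr_rev e f g h k : pencil_cr k h g f e = pencil_cr e f g h k.
Proof.
rewrite /pencil_cr /det3; congr (_ / _); ring.
Qed.

(** Numerator and denominator are both products of two determinants, so the square of the
    determinant of [M] cancels. *)
Lemma pencil_cr_mulmx M e f g h k :
  det3 (col 0 M) (col 1 M) (col 2%:R M) != 0 ->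
  pencil_cr (M *m e) (M *m f) (M *m g) (M *m h) (M *m k) = pencil_cr e f g h k.
Proof.
set D := det3 (col 0 M) _ _ => D0.
have DD0 : D * D != 0 by rewrite mulf_neq0.
rewrite /pencil_cr !det3_mulmx -/D ![D * _ * (D * _)]mulrACA -mulf_div.
by rewrite divff // mul1r.
Qed.

(** The cross-ratio depends on rays only: each vector occurs equally often above and below the
    fraction bar. *)
Lemma pencil_cr_scale a b c d l e f g h k :
  a != 0 -> b != 0 -> c != 0 -> d != 0 -> l != 0 ->
  pencil_cr (a *: e) (b *: f) (c *: g) (d *: h) (l *: k) = pencil_cr e f g h k.
Proof.
move=> a0 b0 c0 d0 l0; rewrite /pencil_cr !det3_scale.
set w := c * a * b * (c * d * l).
have w0 : w != 0 by rewrite !mulf_neq0.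
rewrite [X in X / _ = _](_ : _ = w * (det3 g e f * det3 g h k)); last first.
  by rewrite /w; ring.
rewrite [X in _ / X = _](_ : _ = w * (det3 g e h * det3 g f k)); last first.
  by rewrite /w; ring.
by rewrite -mulf_div divff // mul1r.
Qed.

End Det3.

(** * Isomorphisms between cones over convex polygons *)

Section Polygon.
Variables (R : realType) (m : nat).
Hypothesis m3 : (3 <= m)%N.
Implicit Types (y : 'I_m -> 'cV[R]_3) (M : 'M[R]_3) (i j l : 'I_m).

Definition convex_polygon y :=
  forall i l, l != i -> l != ordS i -> 0 < det3 (y i) (y (ordS i)) (y l).

Lemma ordS_neq i : ordS i != i.
Proof.
apply/eqP => /(congr1 val) /=; case: i => i im /= .
have [e|ne] := eqVneq i.+1 m; first by rewrite e modnn; lia.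
by rewrite modn_small; lia.
Qed.

Lemma ordSS_neq i : ordS (ordS i) != i.
Proof.
apply/eqP => /(congr1 val) /=; case: i => i im /= .
have [e|ne] := eqVneq i.+1 m; first by rewrite e modnn modn_small; lia.
rewrite (@modn_small i.+1); last by lia.
have [e|ne2] := eqVneq i.+2 m; first by rewrite e modnn; lia.
by rewrite modn_small; lia.
Qed.

Lemma cone_gen_mem y j : cone_gen y (y j).
Proof.
exists (fun l => (l == j)%:R) => [l|]; first exact: ler0n.
rewrite (bigD1 j) //= eqxx scale1r big1 ?addr0 // => l /negbTE ->.
by rewrite scale0r.
Qed.

(* A linear functional supporting the cone exactly along the ray of [y j]. *)
Definition ray_support y j (v : 'cV[R]_3) :=
  det3 (y j) (y (ordS j)) v + det3 (y (ord_pred j)) (y j) v.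

Lemma ray_support_self y j : ray_support y j (y j) = 0.
Proof. by rewrite /ray_support /det3; ring. Qed.

Lemma ray_support_sum y j (I : finType) (c : I -> R) (w : I -> 'cV[R]_3) :
  ray_support y j (\sum_i c i *: w i) = \sum_i c i * ray_support y j (w i).
Proof.
rewrite /ray_support !det3_sumr -big_split /=.
by apply: eq_bigr => i _; rewrite -mulrDr.
Qed.

Lemma convex_polygon_pred y j l : convex_polygon y ->
  l != ord_pred j -> l != j -> 0 < det3 (y (ord_pred j)) (y j) (y l).
Proof. by move=> cy lp lj; have := cy _ _ lp; rewrite ord_predK; apply. Qed.

(** Each edge term vanishes only at [j] and at one of its neighbours. The two neighbours differ when
    [3 <= m], so away from [j] the terms never vanish together. *)
Lemma ray_support_gt0 y j l : convex_polygon y -> l != j ->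
  0 < ray_support y j (y l).
Proof.
move=> cy lj; rewrite /ray_support.
have d0 u v : det3 u v v = 0 :> R by rewrite /det3; ring.
have d1 u v : det3 u v u = 0 :> R by rewrite /det3; ring.
have [->|lSj] := eqVneq l (ordS j).
  rewrite d0 add0r; apply: convex_polygon_pred; rewrite ?ordS_neq //.
  by rewrite -(inj_eq (@ordS_inj _)) ord_predK ordSS_neq.
apply: ltr_wpDr; last exact: cy.
have [->|lpj] := eqVneq l (ord_pred j); first by rewrite d1.
exact/ltW/convex_polygon_pred.
Qed.

Lemma ray_support_ge0 y j v : convex_polygon y -> cone_gen y v ->
  0 <= ray_support y j v.
Proof.
move=> cy [c c0 ->]; rewrite ray_support_sum sumr_ge0 // => l _.
rewrite mulr_ge0 //; have [->|lj] := eqVneq l j.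
  by rewrite ray_support_self.
exact/ltW/ray_support_gt0.
Qed.

Lemma ray_support_eq0 y j v : convex_polygon y -> cone_gen y v ->
  ray_support y j v = 0 -> exists2 t, 0 <= t & v = t *: y j.
Proof.
move=> cy [c c0 ->]; rewrite ray_support_sum => /eqP.
have F0 i : 0 <= c i * ray_support y j (y i).
  rewrite mulr_ge0 //; apply: ray_support_ge0 => //; exact: cone_gen_mem.
rewrite psumr_eq0 // => /allP H; exists (c j) => //.
rewrite (bigD1 j) //= big1 ?addr0 // => l lj.
have := H l (mem_index_enum l); rewrite mulf_eq0.
by rewrite (gt_eqF (ray_support_gt0 cy lj)) orbF => /eqP ->; rewrite scale0r.
Qed.

Lemma convex_polygon_neq0 y j : convex_polygon y -> y j != 0.
Proof.
move=> cy; apply/eqP => yj0.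
have := ray_support_gt0 cy (ordS_neq j).
by rewrite /ray_support yj0 /det3 !mxE; lra.
Qed.

(** Extreme rays go to extreme rays. Expand the image of [y2 j] in the rays [y1], pull back, and
    apply the functional supporting the second cone at [y2 j]: a zero sum of nonnegative terms
    forces every ray that occurs to come from the ray of [y2 j]. *)
Lemma cone_iso_ray y1 y2 M j :
  convex_polygon y1 -> convex_polygon y2 -> M \in unitmx ->
  [set M *m x | x in cone_gen y2] = cone_gen y1 ->
  exists l, exists2 c, 0 < c & M *m y2 j = c *: y1 l.
Proof.
move=> cy1 cy2 Mu MK.
have K1M v : cone_gen y1 v -> cone_gen y2 (invmx M *m v).
  by rewrite -MK => -[w wK <-]; rewrite mulKmx.
have : cone_gen y1 (M *m y2 j).
  by rewrite -MK; exists (y2 j) => //; exact: cone_gen_mem.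
move=> [c c0 cE].
have [l cl] : exists l, 0 < c l.
  apply/not_existsP => cN; have cz l : c l = 0.
    by apply/eqP; rewrite eq_le c0 leNgt andbT; apply/negP/cN.
  have : M *m y2 j = 0.
    by rewrite cE big1 // => l _; rewrite cz scale0r.
  move=> /(congr1 (mulmx (invmx M))); rewrite mulKmx // mulmx0 => /eqP.
  by rewrite (negbTE (convex_polygon_neq0 _ cy2)).
have : ray_support y2 j (\sum_l c l *: (invmx M *m y1 l)) = 0.
  rewrite (_ : \sum__ _ = y2 j) ?ray_support_self //.
  rewrite -[RHS](mulKmx Mu) cE mulmx_sumr.
  by apply: eq_bigr => i _; rewrite scalemxAr.
rewrite ray_support_sum => /eqP; rewrite psumr_eq0; last first.
  move=> i _; rewrite mulr_ge0 //; apply: ray_support_ge0 => //.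
  exact/K1M/cone_gen_mem.
move=> /allP /(_ l (mem_index_enum l)); rewrite mulf_eq0 (gt_eqF cl) /= => /eqP.
move=> /(ray_support_eq0 cy2 (K1M _ (cone_gen_mem _ _))) [t t0 tE].
have y1E : y1 l = t *: (M *m y2 j) by rewrite scalemxAr -tE mulKVmx.
have tp : 0 < t.
  rewrite lt_neqAle t0 andbT eq_sym; apply/eqP => tz.
  by have := convex_polygon_neq0 l cy1; rewrite y1E tz scale0r eqxx.
exists l, t^-1; first by rewrite invr_gt0.
by rewrite y1E scalerA mulVf ?gt_eqF // scale1r.
Qed.

Lemma cone_iso_perm y1 y2 M :
  convex_polygon y1 -> convex_polygon y2 -> M \in unitmx ->
  [set M *m x | x in cone_gen y2] = cone_gen y1 ->
  exists s : 'I_m -> 'I_m, exists c : 'I_m -> R,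
  [/\ injective s, forall j, 0 < c j & forall j, M *m y2 j = c j *: y1 (s j)].
Proof.
move=> cy1 cy2 Mu MK.
have /choice[s /choice[c cP]] : forall j, exists l, exists c : R,
    0 < c /\ M *m y2 j = c *: y1 l.
  by move=> j; have [l [c c0 cE]] := cone_iso_ray j cy1 cy2 Mu MK; exists l, c.
exists s, c; split=> [i j sij|j|j]; try by case: (cP j).
have [ci ciE] := cP i; have [cj cjE] := cP j.
(* Rays with the same image would be proportional, which the support functional at [j] excludes. *)
have yij : y2 i = (c i / c j) *: y2 j.
  apply: (can_inj (mulKmx Mu)); rewrite -scalemxAr cjE ciE sij scalerA.
  by rewrite -mulrA mulVf ?gt_eqF // mulr1.
apply/eqP/negPn/negP => /ray_support_gt0 - /(_ _ cy2).
rewrite yij (_ : ray_support _ _ _ = 0) ?ltxx // /ray_support /det3 !mxE.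
ring.
Qed.

(* Cyclic neighbours are recognised by the sign of [det3], and an isomorphism
   multiplies all those signs by the sign of its determinant. *)
Lemma cone_iso_dihedral y1 y2 M (s : 'I_m -> 'I_m) (c : 'I_m -> R) :
  convex_polygon y1 -> convex_polygon y2 -> M \in unitmx -> injective s ->
  (forall j, 0 < c j) -> (forall j, M *m y2 j = c j *: y1 (s j)) ->
  (forall i, s (ordS i) = ordS (s i)) \/
  (forall i, s (ordS i) = ord_pred (s i)).
Proof.
move=> cy1 cy2 /det3_cols_neq0; set D := det3 _ _ _ => D0 sinj c0 cE.
have sg i l : l != i -> l != ordS i ->
    0 < D * det3 (y1 (s i)) (y1 (s (ordS i))) (y1 (s l)).
  move=> li lSi; have := cy2 i l li lSi.
  rewrite -(pmulr_rgt0 _ (_ : 0 < D ^+ 2)) ?exprn_even_gt0 //.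
  rewrite expr2 -mulrA /D -det3_mulmx -/D !cE det3_scale.
  by rewrite mulrCA pmulr_rgt0 // !mulr_gt0.
have [t st ts] := injF_bij sinj.
have sg' i l : l != s i -> l != s (ordS i) ->
    0 < D * det3 (y1 (s i)) (y1 (s (ordS i))) (y1 l).
  by move=> l1 l2; rewrite -(ts l) sg //; rewrite -(inj_eq sinj) ts.
(* [D < 0] reverses the cyclic order and [D > 0] preserves it: if the next ray did not go to the
   expected neighbour, a single determinant would have both signs. *)
have [Dp|Dn|/eqP] := ltgtP D 0; last by rewrite (negbTE D0).
- right=> i; apply/eqP; rewrite -(inj_eq (@ordS_inj _)) ord_predK.
  apply/negPn/negP => ne.
  have h : 0 < D * det3 (y1 (s i)) (y1 (s (ordS i))) (y1 (ord_pred (s i))).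
    apply: sg'; rewrite -(inj_eq (@ordS_inj _)) ord_predK 1?eq_sym //.
    by rewrite ordS_neq.
  have := cy1 (ord_pred (s i)) (s (ordS i)).
  rewrite ord_predK (inj_eq sinj) ordS_neq.
  rewrite det3_rot => /(_ _ isT) h2.
  rewrite nmulr_rgt0 // in h; move: h; rewrite ltNge => /negP; apply.
  apply: ltW; apply: h2.
  by rewrite -(inj_eq (@ordS_inj _)) ord_predK.
- left=> i; apply/eqP/negPn/negP => ne.
  have h : 0 < D * det3 (y1 (s i)) (y1 (s (ordS i))) (y1 (ordS (s i))).
    by apply: sg'; [exact: ordS_neq | rewrite eq_sym].
  have := cy1 (s i) (s (ordS i)).
  rewrite (inj_eq sinj) ordS_neq => /(_ isT ne) h2.
  rewrite pmulr_rgt0 // in h.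
  by rewrite det3_swapr oppr_gt0 in h; have := lt_trans h h2; rewrite ltxx.
Qed.

End Polygon.

(** * Cross-ratios of five consecutive rays, computed symbolically *)

Definition vec3 (R : pzRingType) (a b c : R) : 'cV[R]_3 :=
  \col_(i < 3) [:: a; b; c]`_i.

Section Windows.
Variables (R : realFieldType) (rho q b : R).
Hypotheses (rho0 : 0 < rho) (q0 : 0 < q) (b0 : 0 < b) (b1 : b < 1).
Let a := 1 - b.
(** With [beta] and [rho], the coefficients of the recurrence with characteristic polynomial
    [(X - 1) * (X ^ 2 - q * X + rho)], which produces [e3] and [e4]. *)
Let alpha := 1 + q.
Let beta := rho + q.
Let e0 := vec3 (1 : R) 0 0.
Let e1 := vec3 (0 : R) 1 0.
Let e2 := vec3 (0 : R) 0 1.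
Let e3 := vec3 rho (- beta) alpha.
Let e4 := vec3 (alpha * rho) (rho - alpha * beta) (alpha ^+ 2 - beta).
(** [E] and [N] abbreviate determinants of wrapped points: [det3 m2 m0 m1 = N] and
    [det3 m2 m1 e4 = - (rho * E)] below. *)
Let E := b ^+ 2 * (1 + q) + a * b * (rho + q) + a ^+ 2 * rho.
Let N := b ^+ 2 + a * b * q + a ^+ 2 * rho.

Let a0 : 0 < a. Proof. by rewrite subr_gt0. Qed.

Ltac det3_ring := rewrite /det3 !mxE /= ?/N ?/E ?/alpha ?/beta ?/a; ring.

(* [e0], ..., [e4] are consecutive points of the spiral, in the basis of the
   first three. In [cr_wrapN] the last [N] points of the window are the first
   rays of the cone; the preceding ones are its last rays, expressed through the
   closing relation [x_m = b x_0 + a x_1]. *)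
Lemma cr_regular : pencil_cr e0 e1 e2 e3 e4 = rho / ((rho + q) * (1 + q)).
Proof.
rewrite /pencil_cr (_ : det3 e2 e0 e1 = 1); last by det3_ring.
rewrite (_ : det3 e2 e3 e4 = rho ^+ 2); last by det3_ring.
rewrite (_ : det3 e2 e0 e3 = - (rho + q)); last by det3_ring.
rewrite (_ : det3 e2 e1 e4 = - (rho * (1 + q))); last by det3_ring.
have ? : 0 < rho + q by exact: addr_gt0.
have ? : 0 < 1 + q by exact: addr_gt0.
by field; rewrite !lt0r_neq0.
Qed.

Lemma cr_wrap4 :
  pencil_cr (b *: e0 + a *: e1) e1 e2 e3 e4 =
  b * rho / ((rho + b * q) * (1 + q)).
Proof.
set m0 := _ + _.
rewrite /pencil_cr (_ : det3 e2 m0 e1 = b); last by det3_ring.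
rewrite (_ : det3 e2 e3 e4 = rho ^+ 2); last by det3_ring.
rewrite (_ : det3 e2 m0 e3 = - (rho + b * q)); last by det3_ring.
rewrite (_ : det3 e2 e1 e4 = - (rho * (1 + q))); last by det3_ring.
have ? : 0 < rho + b * q by rewrite addr_gt0 // mulr_gt0.
have ? : 0 < 1 + q by exact: addr_gt0.
by field; rewrite !lt0r_neq0.
Qed.

Lemma cr_wrap3 :
  pencil_cr (b *: e0 + a *: e1) (b *: e1 + a *: e2) e2 e3 e4 =
  b * rho / ((rho + b * q) * (1 + q)).
Proof.
set m0 := b *: e0 + _; set m1 := b *: e1 + _.
rewrite /pencil_cr (_ : det3 e2 m0 m1 = b ^+ 2); last by det3_ring.
rewrite (_ : det3 e2 e3 e4 = rho ^+ 2); last by det3_ring.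
rewrite (_ : det3 e2 m0 e3 = - (rho + b * q)); last by det3_ring.
rewrite (_ : det3 e2 m1 e4 = - (b * rho * (1 + q))); last by det3_ring.
have ? : 0 < rho + b * q by rewrite addr_gt0 // mulr_gt0.
have ? : 0 < 1 + q by exact: addr_gt0.
by field; rewrite !lt0r_neq0.
Qed.

Let E0 : 0 < E.
Proof. by rewrite /E !addr_gt0 // !(mulr_gt0, exprn_gt0) // addr_gt0. Qed.

Let N0 : 0 < N.
Proof. by rewrite /N !addr_gt0 // !(mulr_gt0, exprn_gt0). Qed.

Lemma cr_wrap2 :
  pencil_cr (b *: e0 + a *: e1) (b *: e1 + a *: e2) (b *: e2 + a *: e3) e3 e4 =
  N * rho / (E * (rho + b * q)).
Proof.
set m0 := b *: e0 + _; set m1 := b *: e1 + _; set m2 := b *: e2 + _.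
rewrite /pencil_cr (_ : det3 m2 m0 m1 = N); last by det3_ring.
rewrite (_ : det3 m2 e3 e4 = b * rho ^+ 2); last by det3_ring.
rewrite (_ : det3 m2 m0 e3 = - (b * (rho + b * q))); last by det3_ring.
rewrite (_ : det3 m2 m1 e4 = - (rho * E)); last by det3_ring.
have ? : 0 < rho + b * q by rewrite addr_gt0 // mulr_gt0.
by field; rewrite !lt0r_neq0.
Qed.

Lemma cr_wrap1 :
  pencil_cr (b *: e0 + a *: e1) (b *: e1 + a *: e2) (b *: e2 + a *: e3)
    (b *: e3 + a *: e4) e4 =
  b ^+ 2 * rho / ((rho + q) * E).
Proof.
set m0 := b *: e0 + _; set m1 := b *: e1 + _; set m2 := b *: e2 + _.
set m3 := b *: e3 + _.
rewrite /pencil_cr (_ : det3 m2 m0 m1 = N); last by det3_ring.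
rewrite (_ : det3 m2 m3 e4 = b ^+ 2 * rho ^+ 2); last by det3_ring.
rewrite (_ : det3 m2 m0 m3 = - (N * (rho + q))); last by det3_ring.
rewrite (_ : det3 m2 m1 e4 = - (rho * E)); last by det3_ring.
have ? : 0 < rho + q by rewrite addr_gt0.
by field; rewrite !lt0r_neq0.
Qed.

(** Once denominators are cleared, the gap carries the factor [a]: it would close at [b = 1], where
    the wrapped points become spiral points again. *)
Lemma cr_wrap34_lt : b * rho / ((rho + b * q) * (1 + q)) <
  rho / ((rho + q) * (1 + q)).
Proof.
have ? : 0 < rho + b * q by rewrite addr_gt0 // mulr_gt0.
rewrite ltr_pdivrMr; last by rewrite mulr_gt0 // addr_gt0.
rewrite [ltRHS]mulrAC ltr_pdivlMr; last by rewrite mulr_gt0 // addr_gt0.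
rewrite -subr_gt0.
rewrite (_ : _ - _ = a * rho ^+ 2 * (1 + q)); last by rewrite /a; ring.
by rewrite !mulr_gt0 ?exprn_gt0 // addr_gt0.
Qed.

Lemma cr_wrap1_lt : b ^+ 2 * rho / ((rho + q) * E) <
  rho / ((rho + q) * (1 + q)).
Proof.
rewrite ltr_pdivrMr; last by rewrite mulr_gt0 // addr_gt0.
rewrite [ltRHS]mulrAC ltr_pdivlMr; last by rewrite mulr_gt0 // addr_gt0.
rewrite -subr_gt0.
rewrite (_ : _ - _ = rho * (rho + q) * (a * b * (rho + q) + a ^+ 2 * rho)).
  have ? : 0 < rho + q by exact: addr_gt0.
  by rewrite mulr_gt0 ?addr_gt0 ?mulr_gt0 ?exprn_gt0.
by rewrite /E; ring.
Qed.

(** After clearing denominators, the delicate bracket is [q ^+ 2 * (1 + rho + q) - rho ^+ 2], and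
    the last hypothesis is exactly its nonnegativity. *)
Lemma cr_wrap2_gt : rho < 1 -> rho ^+ 2 <= q ^+ 2 * (1 + rho + q) ->
  rho / ((rho + q) * (1 + q)) < N * rho / (E * (rho + b * q)).
Proof.
move=> rho1 hq.
have ? : 0 < rho + b * q by rewrite addr_gt0 // mulr_gt0.
rewrite ltr_pdivrMr; last by rewrite mulr_gt0 // addr_gt0.
rewrite [ltRHS]mulrAC ltr_pdivlMr; last by rewrite mulr_gt0 //.
rewrite -subr_gt0.
rewrite (_ : _ - _ = rho * (a * (b ^+ 2 * q * (1 - rho)
  + b * (q ^+ 2 * (1 + rho + q) - rho ^+ 2)
  + a * rho * q * (a + rho + q)))).
  have ? : 0 < a + rho + q by rewrite addr_gt0 // addr_gt0.
  have ? : 0 < a * rho * q * (a + rho + q) by rewrite !mulr_gt0.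
  have ? : 0 <= b ^+ 2 * q * (1 - rho).
    by rewrite !mulr_ge0 ?exprn_ge0 ?subr_ge0 ?ltW.
  have ? : 0 <= b * (q ^+ 2 * (1 + rho + q) - rho ^+ 2).
    by rewrite mulr_ge0 ?subr_ge0 // ltW.
  by rewrite !mulr_gt0 // ltr_wpDl // addr_ge0.
by rewrite /E /N /a; ring.
Qed.

End Windows.

(** * Estimates for the angle *)

Section Angle.
Variables (R : realType) (m : nat) (theta : R).
Hypotheses (hm : (6 <= m)%N)
  (htheta : 2 * pi / m%:R < theta < 2 * pi / m.-1%:R).

Let m0 : 0 < m%:R :> R. Proof. by rewrite ltr0n; lia. Qed.
Let m10 : 0 < m.-1%:R :> R. Proof. by rewrite ltr0n; lia. Qed.

Lemma mtheta_gt : 2 * pi < m%:R * theta.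
Proof. by case/andP: htheta => + _; rewrite ltr_pdivrMr // [_ * m%:R]mulrC. Qed.

Lemma m1theta_lt : m.-1%:R * theta < 2 * pi.
Proof.
by case/andP: htheta => _; rewrite ltr_pdivlMr // [_ * m.-1%:R]mulrC.
Qed.

Lemma theta_gt0 : 0 < theta.
Proof.
case/andP: htheta => + _; apply: lt_trans.
by rewrite divr_gt0 // mulr_gt0 ?pi_gt0.
Qed.

Lemma mtheta_split : m%:R * theta = m.-1%:R * theta + theta.
Proof.
have /prednK {1}<- : (0 < m)%N by lia.
by rewrite -natr1 mulrDl mul1r.
Qed.

(** The form in which [6 <= m] bounds the angle: [theta] is below a fifth of a turn, hence acute. *)
Lemma theta5_lt : 5 * theta < 2 * pi.
Proof.
apply: le_lt_trans m1theta_lt; apply: ler_wpM2r; first exact/ltW/theta_gt0.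
by rewrite (ler_nat _ 5); lia.
Qed.

Lemma sin_theta_gt0 : 0 < sin theta.
Proof.
apply: sin_gt0_pi; rewrite theta_gt0 /=.
by have := theta5_lt; have := theta_gt0; lra.
Qed.

(** [m * theta] exceeds a full turn by less than [theta]. *)
Lemma sin_mtheta_gt0 : 0 < sin (m%:R * theta).
Proof.
rewrite -[_ * theta](subrK (pi *+ 2)) sinD2pi.
apply: sin_gt0_pi; rewrite mulr2n.
have := mtheta_gt; have := m1theta_lt; have := theta5_lt; have := theta_gt0.
by rewrite mtheta_split; lra.
Qed.

Lemma sin_lt0 (x : R) : pi < x < 2 * pi -> sin x < 0.
Proof.
move=> /andP[x1 x2]; rewrite -[x](subrK pi) sinDpi oppr_lt0.
by apply: sin_gt0_pi; lra.
Qed.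

(** [(m - 1) * theta] falls short of a full turn by less than [theta], hence by less than [pi]. *)
Lemma sin_m1theta_lt0 : sin (m.-1%:R * theta) < 0.
Proof.
apply: sin_lt0; rewrite m1theta_lt andbT.
have := mtheta_gt; rewrite mtheta_split.
by have := theta5_lt; have := theta_gt0; lra.
Qed.

Lemma cos_theta_gt0 : 0 < cos theta.
Proof.
apply: cos_gt0_pihalf.
by have := theta5_lt; have := theta_gt0; have := pi_gt0 R; lra.
Qed.

(* [2 cos (2 pi / 5)] is the positive root of [X ^+ 2 + X - 1]. *)
Lemma cos_theta_lbound : 1 < (2 * cos theta) ^+ 2 + 2 * cos theta.
Proof.
have s0 := sin_theta_gt0.
(* Twice this product is [sin (3 theta) + sin (2 theta)], which is [sin theta] times the quadratic
   in [2 cos theta]; positivity comes from [5 theta < 2 pi]. *)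
have : 0 < sin (2 * theta + theta / 2) * cos (theta / 2).
  have := theta5_lt; have := theta_gt0; have := pi_gt0 R => ? ? ?.
  by rewrite mulr_gt0 ?sin_gt0_pi ?cos_gt0_pihalf //; lra.
have h2 : theta = theta / 2 + theta / 2 by lra.
set u := theta / 2 in h2 *.
have cu : cos u ^+ 2 = 1 - sin u ^+ 2 by rewrite cos2sin2.
have e : 2 * (sin (2 * theta + u) * cos u) =
  sin theta * ((2 * cos theta) ^+ 2 + 2 * cos theta - 1).
  have -> : 2 * theta + u = u + u + (u + u) + u by lra.
  rewrite h2 !(sinD, cosD).
  ring: cu.
rewrite -(pmulr_rgt0 _ (ltr0n R 2)) e pmulr_rgt0 //; lra.
Qed.

End Angle.

(** * The logarithmic spiral: shifts, recurrence and determinants *)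

Section Spiral.
Variables (R : realType) (r theta : R).

Definition spiral (j : nat) : 'cV[R]_3 :=
  vec3 (r ^+ j * cos (j%:R * theta)) (r ^+ j * sin (j%:R * theta)) 1.

(** Multiplication by [omega^n] on the first two coordinates and the identity on the third. *)
Definition spiral_mx (n : nat) : 'M[R]_3 :=
  let c := r ^+ n * cos (n%:R * theta) in
  let s := r ^+ n * sin (n%:R * theta) in
  \matrix_(i < 3, j < 3)
    [:: vec3 c s 0; vec3 (- s) c 0; vec3 0 0 1]`_j i 0.

Lemma spiral_add n j : spiral (n + j) = spiral_mx n *m spiral j.
Proof.
apply/colP => i; rewrite !mxE sum_ord3 !mxE /= !natrD !mulrDl cosD sinD exprD.
case: i => -[|[|[|]]] //= _; ring.
Qed.

Lemma det3_spiral_mx n :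
  det3 (col 0 (spiral_mx n)) (col 1 (spiral_mx n)) (col 2%:R (spiral_mx n)) =
  (r ^+ n) ^+ 2.
Proof.
have cn := cos2sin2 (n%:R * theta).
by rewrite /det3 !mxE /=; ring: cn.
Qed.

Lemma det3_spiral_add n i j k :
  det3 (spiral (n + i)) (spiral (n + j)) (spiral (n + k)) =
  (r ^+ n) ^+ 2 * det3 (spiral i) (spiral j) (spiral k).
Proof. by rewrite !spiral_add det3_mulmx det3_spiral_mx. Qed.

(** [rho] is the squared modulus of [omega], [q] is twice its real part, and [tau] is the squared
    modulus of [1 - omega]. *)
Let rho := r ^+ 2.
Let q := r * (2 * cos theta).
Let tau := 1 + rho - q.

(** The coordinates combine the powers of [1], [omega] and its conjugate, the roots of
    [(X - 1) * (X ^ 2 - q * X + rho)]. A shift reduces the check to index 0. *)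
Lemma spiral_rec j : spiral j.+3 =
  (1 + q) *: spiral j.+2 - (rho + q) *: spiral j.+1 + rho *: spiral j.
Proof.
rewrite -[j.+3]addn3 -[j.+2]addn2 -[j.+1]addn1 -[j in rho *: spiral j]addn0.
rewrite !spiral_add !scalemxAr -mulmxBr -mulmxDr; congr (_ *m _).
have e2 : 2 * theta = theta + theta by lra.
have e3 : 3 * theta = theta + theta + theta by lra.
have cu := cos2sin2 theta.
apply/colP => i; rewrite !mxE /= e2 e3 (mul0r theta) (mul1r theta) cos0 sin0.
rewrite !(cosD, sinD).
by case: i => -[|[|[|]]] //= _; rewrite /rho /q; ring: cu.
Qed.

Lemma spiral_linear n a b : spiral n = b *: spiral 0 + a *: spiral 1 ->
  forall j, spiral (n + j) = b *: spiral j + a *: spiral j.+1.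
Proof.
move=> nE j; rewrite addnC spiral_add nE mulmxDr -!scalemxAr -!spiral_add.
by rewrite addn0 addn1.
Qed.

Lemma det3_spiral012 :
  det3 (spiral 0) (spiral 1) (spiral 2) = r * sin theta * tau.
Proof.
have e2 : 2 * theta = theta + theta by lra.
have cu := cos2sin2 theta.
rewrite /det3 !mxE /= e2 (mul0r theta) (mul1r theta) cos0 sin0.
rewrite !(cosD, sinD) /tau /rho /q.
ring: cu.
Qed.

(** A first-order recurrence whose increment has the sign of a sine once [r] and [tau] are positive,
    the shape that [unimodal_gt0] takes; likewise [det3_spiral_bwd], with factor [rho]. *)
Lemma det3_spiral_fwd n :
  det3 (spiral 0) (spiral 1) (spiral n.+1) =
  det3 (spiral 0) (spiral 1) (spiral n) + tau * (r ^+ n * sin (n%:R * theta)).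
Proof.
have cu := cos2sin2 theta.
rewrite /det3 !mxE /= (mul0r theta) (mul1r theta) cos0 sin0 -natr1.
rewrite mulrDl (mul1r theta) !(cosD, sinD) !exprS.
rewrite /tau /rho /q.
ring: cu.
Qed.

Lemma det3_spiral_bwd n :
  det3 (spiral n.+1) (spiral n.+2) (spiral 0) =
  rho * det3 (spiral n) (spiral n.+1) (spiral 0) +
  tau * (r ^+ n.+1 * sin (n.+1%:R * theta)).
Proof.
have cu := cos2sin2 theta.
have cn := cos2sin2 (n%:R * theta).
rewrite /det3 !mxE /= (mul0r theta) cos0 sin0 -[n.+2%:R]natr1 -![n.+1%:R]natr1.
rewrite !mulrDl (mul1r theta) !(cosD, sinD) !exprS /tau /rho /q.
ring: cu cn.
Qed.

End Spiral.

(** * The radius and the closing relation of the spiral *)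

Section Radius.
Variables (R : realType) (m : nat) (theta : R).
Hypotheses (hm : (6 <= m)%N)
  (htheta : 2 * pi / m%:R < theta < 2 * pi / m.-1%:R).

Let s0 : 0 < sin theta := sin_theta_gt0 hm htheta.
Let sm0 : 0 < sin (m%:R * theta) := sin_mtheta_gt0 hm htheta.
Let sm10 : sin (m.-1%:R * theta) < 0 := sin_m1theta_lt0 hm htheta.
Let r := r_theta m theta.

Lemma r_thetaP : 0 < r /\ g_theta m theta r = 0.
Proof.
rewrite /r /r_theta; set S := [set t | _].
suff [t St] : exists t, S t by exact: (@xgetPex _ 0 S (ex_intro _ t St)).
pose A := sin (m.-1%:R * theta) / sin theta.
pose B := sin (m%:R * theta) / sin theta.
have A0 : A < 0 by rewrite /A pmulr_llt0 ?invr_gt0.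
have B0 : 0 < B by rewrite /B divr_gt0.
pose p : {poly R} := B *: 'X^(m.-1) - A *: 'X^m - 1.
have pE t : p.[t] = - g_theta m theta t.
  by rewrite /p /g_theta !hornerE -/A -/B; ring.
have g0 : g_theta m theta 0 = 1.
  have [mz m1z] : (m == 0)%N = false /\ (m.-1 == 0)%N = false.
    by split; apply/eqP; lia.
  by rewrite /g_theta (expr0n _ m) (expr0n _ m.-1) mz m1z !mulr0 subr0 add0r.
(* Chosen so that [A * T = A - 1]. As [1 <= T], this gives [g_theta m theta T <= A < 0], while the
   value at 0 is 1. *)
pose T := 1 - A^-1.
have T1 : 1 <= T by rewrite /T lerBrDr gerDl invr_le0 ltW.
have T0 : 0 <= T by apply: le_trans T1.
have pT : p.[0] <= 0 <= p.[T].
  rewrite !pE g0 lerN10 oppr_ge0 /g_theta -/A -/B.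
  have TT : T <= T ^+ m by apply: ler_eXnr => //; lia.
  have h1 : A * T ^+ m <= A * T by rewrite ler_nM2l.
  have h2 : 0 <= B * T ^+ m.-1 by rewrite mulr_ge0 ?exprn_ge0 // ltW.
  have h3 : A * T = A - 1 by rewrite /T mulrBr mulr1 mulfV ?lt_eqF.
  lra.
have [t /andP[t0 tT] /rootP pt] := poly_ivt T0 pT.
exists t; split; last by apply/eqP; rewrite -oppr_eq0 -pE pt.
rewrite lt_neqAle t0 andbT; apply/eqP => tz.
by move: pt; rewrite pE -tz g0 => /eqP; rewrite oppr_eq0 oner_eq0.
Qed.

Let r0 : 0 < r := r_thetaP.1.

(** The weight of ray 0 in the closing relation [spiral_wrap]; the equation [g_theta m theta r = 0]
    says that the other weight is [1 - b]. *)
Definition wrap_coef := - (sin (m.-1%:R * theta) / sin theta * r ^+ m).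
Let b := wrap_coef.

Lemma wrap_coef_gt0 : 0 < b.
Proof.
by rewrite /b /wrap_coef oppr_gt0 pmulr_llt0 ?exprn_gt0 // pmulr_llt0 ?invr_gt0.
Qed.

Lemma wrap_coefE : 1 - b = sin (m%:R * theta) / sin theta * r ^+ m.-1.
Proof.
have [_] := r_thetaP; rewrite /g_theta /b /wrap_coef; lra.
Qed.

Lemma wrap_coef_lt1 : b < 1.
Proof.
by rewrite -subr_gt0 wrap_coefE mulr_gt0 ?exprn_gt0 // divr_gt0.
Qed.

Lemma spiral_wrap :
  spiral r theta m = b *: spiral r theta 0 + (1 - b) *: spiral r theta 1.
Proof.
have mE : m = m.-1.+1 by lia.
have e : m.-1%:R * theta = m%:R * theta - theta.
  by rewrite (mtheta_split hm htheta); ring.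
have rm : r ^+ m = r * r ^+ m.-1 by rewrite -exprS -mE.
have cE : r ^+ m * cos (m%:R * theta) = b + (1 - b) * (r * cos theta).
  rewrite wrap_coefE /b /wrap_coef e sinB rm.
  by field; rewrite gt_eqF.
have sE : r ^+ m * sin (m%:R * theta) = (1 - b) * (r * sin theta).
  by rewrite wrap_coefE rm; field; rewrite gt_eqF.
apply/colP => i; rewrite !mxE /= (mul0r theta) (mul1r theta) cos0 sin0.
case: i => -[|[|[|]]] //= _; rewrite ?cE ?sE; ring.
Qed.

(** If [1 <= r], the strict triangle inequality for [omega^m = b + (1 - b) * omega] gives
    [r ^+ m < b + (1 - b) * r <= r <= r ^+ m]. *)
Lemma r_theta_lt1 : r < 1.
Proof.
rewrite ltNge; apply/negP => r1.
have b0 := wrap_coef_gt0; have b1 := wrap_coef_lt1.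
have h := spiral_wrap.
have hc := congr1 (fun v : 'cV[R]_3 => v 0 0) h.
have hs := congr1 (fun v : 'cV[R]_3 => v 1 0) h.
rewrite !mxE /= (mul0r theta) (mul1r theta) cos0 sin0 in hc hs.
have c2 := cos2Dsin2 (m%:R * theta); have c1 := cos2Dsin2 theta.
have cl : cos theta < 1.
  rewrite lt_neqAle cos_le1 andbT; apply/eqP => c1E.
  move: c1; rewrite c1E expr1n => /eqP.
  by rewrite -subr_eq0 addrC addKr sqrf_eq0 gt_eqF.
have rr : r <= r ^+ m by apply: ler_eXnr => //; lia.
have N : (r ^+ m) ^+ 2 =
  b ^+ 2 + 2 * b * (1 - b) * r * cos theta + (1 - b) ^+ 2 * r ^+ 2.
  have -> : (r ^+ m) ^+ 2 =
    (r ^+ m * cos (m%:R * theta)) ^+ 2 + (r ^+ m * sin (m%:R * theta)) ^+ 2.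
    by rewrite !exprMn -mulrDr c2 mulr1.
  have cs := cos2sin2 theta.
  rewrite hc hs; ring: cs.
have lt1 : b ^+ 2 + 2 * b * (1 - b) * r * cos theta + (1 - b) ^+ 2 * r ^+ 2 <
    (b + (1 - b) * r) ^+ 2.
  rewrite -subr_gt0 (_ : _ - _ = 2 * b * (1 - b) * r * (1 - cos theta)).
    2: by ring.
  by rewrite !mulr_gt0 ?subr_gt0.
have : (b + (1 - b) * r) ^+ 2 <= (r ^+ m) ^+ 2.
  have p0 : 0 <= b + (1 - b) * r.
    by rewrite ltW // addr_gt0 // mulr_gt0 ?subr_gt0.
  have pr : b + (1 - b) * r <= r ^+ m.
    apply: le_trans rr.
    rewrite -subr_ge0 (_ : _ - _ = b * (r - 1)); last by ring.
    by rewrite mulr_ge0 ?subr_ge0 // ltW.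
  by rewrite ler_pXn2r // nnegrE exprn_ge0 // ltW.
by rewrite N leNgt lt1.
Qed.

End Radius.

(* While the increments are nonnegative positivity propagates upwards, and once
   they are nonpositive it propagates downwards from [N]. *)
Lemma unimodal_gt0 (R : realDomainType) (lam : R) (S e : nat -> R)
    (P : pred nat) (n0 N : nat) :
  0 < lam -> 0 < S n0 -> 0 < S N ->
  (forall n, S n.+1 = lam * S n + e n) ->
  (forall n, P n.+1 -> P n) ->
  (forall n, P n -> 0 <= e n) ->
  (forall n, (n < N)%N -> ~~ P n -> e n <= 0) ->
  forall n, (n0 <= n <= N)%N -> 0 < S n.
Proof.
move=> lam0 S0 SN SE PS eP eN n /andP[].
elim: n => [|n IH n0n nN]; first by rewrite leqn0 => /eqP <-.
have [<-//|ne] := eqVneq n0 n.+1.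
have {IH}Sn : 0 < S n by apply: IH; lia.
have [Pn|Pn] := boolP (P n).
  by rewrite SE ltr_wpDr ?mulr_gt0 ?eP.
rewrite ltNge; apply/negP => Sn1.
suff H k : (n.+1 + k <= N)%N -> ~~ P (n + k)%N && (S (n.+1 + k)%N <= 0).
  by have := H (N - n.+1)%N; rewrite subnKC // leNgt SN andbF => /(_ (leqnn _)).
elim: k => [_|k IH kN]; first by rewrite !addn0 Pn.
have /andP[Pk Sk] : ~~ P (n + k)%N && (S (n.+1 + k)%N <= 0) by apply: IH; lia.
have Pk1 : ~~ P (n + k).+1%N by apply: contra Pk; apply: PS.
rewrite addnS Pk1 /= addnS SE -oppr_ge0 opprD addr_ge0 // oppr_ge0.
  by rewrite pmulr_rle0.
by rewrite addSn eN //; lia.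
Qed.

(** * Cyclic neighbours of an index *)

Lemma ordS_spec m (i : 'I_m) :
  (i.+1 < m)%N /\ nat_of_ord (ordS i) = i.+1 \/
  (i.+1 = m)%N /\ nat_of_ord (ordS i) = 0%N.
Proof.
have im := ltn_ord i; rewrite /=; case: (ltnP i.+1 m) => mi.
  by left; rewrite modn_small.
by right; rewrite (_ : i.+1 = m) ?modnn //; lia.
Qed.

Lemma ord_pred_spec m (i : 'I_m) :
  (0 < i)%N /\ nat_of_ord (ord_pred i) = i.-1 \/
  nat_of_ord i = 0%N /\ nat_of_ord (ord_pred i) = m.-1.
Proof.
have im := ltn_ord i; rewrite /=; case: (ltnP 0 i) => i0.
  by left; rewrite (_ : (i + m).-1 = i.-1 + m)%N ?modnDr ?modn_small; lia.
by right; rewrite (_ : nat_of_ord i = 0%N) ?add0n ?modn_small; lia.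
Qed.

Definition ord_window m (i : 'I_m) (n0 n1 n3 n4 : nat) :=
  [/\ nat_of_ord (ord_pred (ord_pred i)) = n0, nat_of_ord (ord_pred i) = n1,
      nat_of_ord (ordS i) = n3 & nat_of_ord (ordS (ordS i)) = n4].

Ltac ord_window_cases i :=
  have := ltn_ord i;
  case: (ord_pred_spec i) => -[? ?];
  case: (ord_pred_spec (ord_pred i)) => -[? ?];
  case: (ordS_spec i) => -[? ?]; case: (ordS_spec (ordS i)) => -[? ?] *;
  split; lia.

Section OrdWindow.
Variables (m : nat) (i : 'I_m).
Hypothesis m4 : (4 <= m)%N.

Lemma ord_window_mid : (2 <= i < m.-2)%N -> ord_window i i.-2 i.-1 i.+1 i.+2.
Proof. ord_window_cases i. Qed.

Lemma ord_window0 : nat_of_ord i = 0%N -> ord_window i m.-2 m.-1 1 2.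
Proof. ord_window_cases i. Qed.

Lemma ord_window1 : nat_of_ord i = 1%N -> ord_window i m.-1 0 2 3.
Proof. ord_window_cases i. Qed.

Lemma ord_window_m2 :
  nat_of_ord i = m.-2 -> ord_window i (m - 4) (m - 3) m.-1 0.
Proof. ord_window_cases i. Qed.

Lemma ord_window_m1 : nat_of_ord i = m.-1 -> ord_window i (m - 3) m.-2 0 1.
Proof. ord_window_cases i. Qed.

End OrdWindow.

(** * Convexity of the spiral polygon and the cross-ratios at its vertices *)

Section SpiralPolygon.
Variables (R : realType) (m : nat) (theta : R).
Hypotheses (hm : (6 <= m)%N)
  (htheta : 2 * pi / m%:R < theta < 2 * pi / m.-1%:R).

Let r := r_theta m theta.
Let sp := spiral r theta.
Let b := wrap_coef m theta.
Let r0 : 0 < r := (r_thetaP hm htheta).1.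
Let r1 : r < 1 := r_theta_lt1 hm htheta.
Let b0 : 0 < b := wrap_coef_gt0 hm htheta.
Let b1 : b < 1 := wrap_coef_lt1 hm htheta.
Let theta0 : 0 < theta := theta_gt0 hm htheta.
Let rho := r ^+ 2.
Let q := r * (2 * cos theta).
Let tau := 1 + rho - q.

Let rho0 : 0 < rho. Proof. exact: exprn_gt0. Qed.

Lemma tau_gt0 : 0 < tau.
Proof.
rewrite /tau /rho /q (_ : _ - _ = (1 - r) ^+ 2 + 2 * r * (1 - cos theta)).
  2: by ring.
rewrite ltr_pwDl ?exprn_gt0 ?subr_gt0 // mulr_ge0 ?subr_ge0 ?cos_le1 //.
by rewrite mulr_ge0 // ltW.
Qed.

Lemma det3_012_gt0 : 0 < det3 (sp 0) (sp 1) (sp 2).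
Proof.
by rewrite det3_spiral012 !mulr_gt0 ?(sin_theta_gt0 hm htheta) ?tau_gt0.
Qed.

Let shift n i j k : det3 (sp (n + i)) (sp (n + j)) (sp (n + k)) =
  (r ^+ n) ^+ 2 * det3 (sp i) (sp j) (sp k).
Proof. exact: det3_spiral_add. Qed.

Lemma spiral_wrap_add j : sp (m + j) = b *: sp j + (1 - b) *: sp j.+1.
Proof. exact/spiral_linear/spiral_wrap. Qed.

(** The first half-turn. The increments are nonnegative on it and negative from there up to [m - 1],
    since [(m - 1) * theta < 2 pi]. *)
Let P (n : nat) := n%:R * theta <= pi.

Let PS n : P n.+1 -> P n.
Proof.
by apply: le_trans; rewrite ler_wpM2r ?ltW // ltr_nat.
Qed.

Let eP n : P n -> 0 <= tau * (r ^+ n * sin (n%:R * theta)).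
Proof.
move=> Pn; rewrite mulr_ge0 ?(ltW tau_gt0) // mulr_ge0 ?exprn_ge0 ?(ltW r0) //.
by apply: sin_ge0_pi; apply/andP; split; rewrite ?mulr_ge0 // ltW.
Qed.

Let eN n : (n <= m.-1)%N -> ~~ P n -> tau * (r ^+ n * sin (n%:R * theta)) < 0.
Proof.
move=> nm; rewrite /P -ltNge => Pn.
rewrite pmulr_rlt0 ?tau_gt0 // pmulr_rlt0 ?exprn_gt0 //; apply: sin_lt0.
rewrite Pn /=; apply: le_lt_trans (m1theta_lt hm htheta).
by rewrite ler_wpM2r ?ler_nat // ltW.
Qed.

(** At the upper end, the determinant for index [m] is zero by the closing relation and the last
    increment is negative, so the value at [m - 1] is positive. *)
Lemma det3_fwd_gt0 n : (2 <= n <= m.-1)%N -> 0 < det3 (sp 0) (sp 1) (sp n).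
Proof.
apply: (@unimodal_gt0 R 1 (fun n => det3 (sp 0) (sp 1) (sp n))
  (fun n => tau * (r ^+ n * sin (n%:R * theta))) P) => //.
- exact: det3_012_gt0.
- have := det3_spiral_fwd r theta m.-1.
  rewrite prednK; last by lia.
  rewrite -/sp (_ : det3 (sp 0) (sp 1) (sp m) = 0); last first.
    by rewrite -[m]addn0 spiral_wrap_add /det3 !mxE; ring.
  have : tau * (r ^+ m.-1 * sin (m.-1%:R * theta)) < 0.
    apply: eN => //; rewrite /P -ltNge.
    have := mtheta_gt hm htheta; rewrite (mtheta_split hm htheta).
    have := theta5_lt hm htheta; have := theta0; lra.
  rewrite -/rho -/q -/tau; lra.
- by move=> k; rewrite mul1r det3_spiral_fwd.
- by move=> k km Pk; apply/ltW/eN => //; lia.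
Qed.

(** At the upper end, a shift by 2 and the closing relation turn the determinant into
    [b ^+ 2 * det3 (sp 0) (sp 1) (sp 2)]. *)
Lemma det3_bwd_gt0 n : (1 <= n <= m.-2)%N -> 0 < det3 (sp n) (sp n.+1) (sp 0).
Proof.
apply: (@unimodal_gt0 R rho (fun n => det3 (sp n) (sp n.+1) (sp 0))
  (fun n => tau * (r ^+ n.+1 * sin (n.+1%:R * theta))) (fun n => P n.+1)) => //.
- by rewrite -det3_rot det3_012_gt0.
- have := shift 2 m.-2 m.-1 0.
  rewrite (_ : 2 + m.-2 = m + 0)%N; last by clear -hm; lia.
  rewrite (_ : 2 + m.-1 = m + 1)%N; last by clear -hm; lia.
  rewrite !spiral_wrap_add.
  rewrite (_ : det3 _ _ _ = b ^+ 2 * det3 (sp 0) (sp 1) (sp 2)); last first.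
    by rewrite /det3 !mxE; ring.
  rewrite (_ : m.-2.+1 = m.-1)%N; last by lia.
  move=> h; rewrite -(pmulr_rgt0 _ (_ : 0 < (r ^+ 2) ^+ 2)) ?exprn_gt0 //.
  by rewrite -h mulr_gt0 ?exprn_gt0 // det3_012_gt0.
- by move=> k; rewrite det3_spiral_bwd.
- by move=> k; apply: PS.
- by move=> k; apply: eP.
- by move=> k km Pk; apply/ltW/eN => //; lia.
Qed.

Lemma x_thetaE (j : 'I_m) : x_theta theta j = sp j.
Proof. by []. Qed.

(** An edge inside the spiral is shifted back until the smallest index is 0. The edge from the last
    ray to ray 0 is shifted forward by one, and the closing relation applies. *)
Lemma x_theta_convex : convex_polygon (@x_theta R m theta).
Proof.
move=> i l li lSi; rewrite !x_thetaE.
have im := ltn_ord i; have lm := ltn_ord l.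
have {}li : nat_of_ord l != i by [].
have {lSi} : nat_of_ord l != ordS i by [].
case: (ordS_spec i) => -[i1m ->].
  move=> lSi; have [il|il] := ltnP i l.
    have := shift i 0 1 (l - i); rewrite addn0 addn1 subnKC; last by lia.
    move=> ->; rewrite mulr_gt0 ?exprn_gt0 // det3_fwd_gt0 //; lia.
  have := shift l (i - l) (i - l).+1 0; rewrite addn0 addnS subnKC //.
  by move=> ->; rewrite mulr_gt0 ?exprn_gt0 // det3_bwd_gt0 //; lia.
move=> l0; have := shift 1 i 0 l.
rewrite (_ : 1 + i = m + 0)%N; last by clear -i1m; lia.
rewrite spiral_wrap_add addn0 add1n.
rewrite (_ : det3 _ _ _ = b * det3 (sp 0) (sp 1) (sp l.+1)); last first.
  by rewrite /det3 !mxE; ring.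
move=> h; rewrite -(pmulr_rgt0 _ (_ : 0 < (r ^+ 1) ^+ 2)) ?exprn_gt0 //.
by rewrite -h mulr_gt0 // det3_fwd_gt0 //; lia.
Qed.

Definition spiral_basis : 'M[R]_3 :=
  \matrix_(i, j) [:: sp 0; sp 1; sp 2]`_j i 0.

Lemma spiral_basisE x y z :
  spiral_basis *m vec3 x y z = x *: sp 0 + y *: sp 1 + z *: sp 2.
Proof. by apply/colP => i; rewrite !mxE sum_ord3 !mxE /=; ring. Qed.

Lemma det3_spiral_basis : det3 (col 0 spiral_basis) (col 1 spiral_basis)
  (col 2%:R spiral_basis) != 0.
Proof.
rewrite (_ : det3 _ _ _ = det3 (sp 0) (sp 1) (sp 2)) ?gt_eqF ?det3_012_gt0 //.
by rewrite /det3 !mxE.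
Qed.

Let coords :=
  [:: vec3 (1 : R) 0 0; vec3 0 1 0; vec3 0 0 1; vec3 rho (- (rho + q)) (1 + q);
   vec3 ((1 + q) * rho) (rho - (1 + q) * (rho + q)) ((1 + q) ^+ 2 - (rho + q))].

Lemma spiral_coords j : (j < 5)%N -> sp j = spiral_basis *m coords`_j.
Proof.
have h3 := spiral_rec r theta 0; have h4 := spiral_rec r theta 1.
rewrite -/rho -/q -/sp in h3 h4.
case: j => [|[|[|[|[|]]]]] //= _; rewrite spiral_basisE ?h4 ?h3;
  by apply/colP => i; rewrite !mxE; ring.
Qed.

Definition window_cr (y : 'I_m -> 'cV[R]_3) (i : 'I_m) : R :=
  pencil_cr (y (ord_pred (ord_pred i))) (y (ord_pred i)) (y i)
    (y (ordS i)) (y (ordS (ordS i))).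

Let v := window_cr (@x_theta R m theta).
Let C := rho / ((rho + q) * (1 + q)).

(** Applied with [n] the number of rays of the window that precede the jump from [m - 1] to 0: these
    become points [sp (m + j)], which [wrap_coords] resolves. *)
Let cr_shift n e f g h k : pencil_cr e f g h k =
  pencil_cr (spiral_mx r theta n *m e) (spiral_mx r theta n *m f)
    (spiral_mx r theta n *m g) (spiral_mx r theta n *m h)
    (spiral_mx r theta n *m k).
Proof.
by rewrite pencil_cr_mulmx // det3_spiral_mx !expf_neq0 // gt_eqF.
Qed.

Let q0 : 0 < q.
Proof. by rewrite !mulr_gt0 // (cos_theta_gt0 hm htheta). Qed.

Let wrap_coords j : (j < 4)%N ->
  sp (m + j) = spiral_basis *m (b *: coords`_j + (1 - b) *: coords`_j.+1).
Proof.
move=> j4; rewrite spiral_wrap_add (spiral_coords (leqW j4)).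
rewrite (@spiral_coords j.+1 j4).
by rewrite mulmxDr -!scalemxAr.
Qed.

Let vE (i : 'I_m) (n0 n1 n3 n4 : nat) : ord_window i n0 n1 n3 n4 ->
  v i = pencil_cr (sp n0) (sp n1) (sp i) (sp n3) (sp n4).
Proof. by move=> [<- <- <- <-]. Qed.

Let m4 : (4 <= m)%N. Proof. by lia. Qed.

Lemma window_cr_regular (i : 'I_m) : (2 <= i < m.-2)%N -> v i = C.
Proof.
move=> iP; rewrite (vE (ord_window_mid m4 iP)).
have [k ->] : exists k, nat_of_ord i = k.+2.
  by exists i.-2; clear -iP; lia.
transitivity (pencil_cr (sp (k + 0)) (sp (k + 1)) (sp (k + 2)) (sp (k + 3))
  (sp (k + 4))); first by rewrite addn0 addn1 addn2 addn3 addn4.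
rewrite /sp !spiral_add -/sp -cr_shift !spiral_coords //.
rewrite pencil_cr_mulmx ?det3_spiral_basis //; exact: cr_regular.
Qed.

Lemma window_cr_wrap4 (i : 'I_m) : nat_of_ord i = 1%N -> v i < C.
Proof.
move=> i1; rewrite (vE (ord_window1 m4 i1)) i1.
rewrite (cr_shift 1) /sp -!spiral_add -/sp.
rewrite (_ : 1 + m.-1 = m + 0)%N; last by clear -hm; lia.
rewrite wrap_coords // !spiral_coords // pencil_cr_mulmx ?det3_spiral_basis //.
by rewrite cr_wrap4 // cr_wrap34_lt.
Qed.

Lemma window_cr_wrap3 (i : 'I_m) : nat_of_ord i = 0%N -> v i < C.
Proof.
move=> i0; rewrite (vE (ord_window0 m4 i0)) i0.
rewrite (cr_shift 2) /sp -!spiral_add -/sp.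
rewrite (_ : 2 + m.-2 = m + 0)%N; last by clear -hm; lia.
rewrite (_ : 2 + m.-1 = m + 1)%N; last by clear -hm; lia.
rewrite !wrap_coords // !spiral_coords // pencil_cr_mulmx ?det3_spiral_basis //.
by rewrite cr_wrap3 // cr_wrap34_lt.
Qed.

Lemma window_cr_wrap1 (i : 'I_m) : nat_of_ord i = m.-2 -> v i < C.
Proof.
move=> iE; rewrite (vE (ord_window_m2 m4 iE)) iE.
rewrite (cr_shift 4) /sp -!spiral_add -/sp.
rewrite (_ : 4 + (m - 4) = m + 0)%N; last by clear -hm; lia.
rewrite (_ : 4 + (m - 3) = m + 1)%N; last by clear -hm; lia.
rewrite (_ : 4 + m.-2 = m + 2)%N; last by clear -hm; lia.
rewrite (_ : 4 + m.-1 = m + 3)%N; last by clear -hm; lia.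
rewrite !wrap_coords // !spiral_coords // pencil_cr_mulmx ?det3_spiral_basis //.
by rewrite cr_wrap1 // cr_wrap1_lt.
Qed.

Lemma window_cr_wrap2 (i : 'I_m) : nat_of_ord i = m.-1 -> C < v i.
Proof.
move=> iE; rewrite (vE (ord_window_m1 m4 iE)) iE.
rewrite (cr_shift 3) /sp -!spiral_add -/sp.
rewrite (_ : 3 + (m - 3) = m + 0)%N; last by clear -hm; lia.
rewrite (_ : 3 + m.-2 = m + 1)%N; last by clear -hm; lia.
rewrite (_ : 3 + m.-1 = m + 2)%N; last by clear -hm; lia.
rewrite !wrap_coords // !spiral_coords // pencil_cr_mulmx ?det3_spiral_basis //.
rewrite cr_wrap2 // cr_wrap2_gt //; first by rewrite exprn_ilt1 ?(ltW r0).
have k1 := cos_theta_lbound hm htheta.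
have c0 := cos_theta_gt0 hm htheta.
rewrite /q /rho; set k := 2 * cos theta in k1 *.
have k0 : 0 < k by rewrite mulr_gt0.
(* [k ^ 3 + 2 k ^ 2 = k (k ^ 2 + k) + k ^ 2 > k + k ^ 2 > 1]. With [r < 1] this yields the
   inequality that [cr_wrap2_gt] asks for. *)
have h : 1 < k * (k * (2 + k)) by nra.
have r2 : r ^+ 2 < 1 by rewrite exprn_ilt1 ?(ltW r0).
have r3 : r ^+ 2 < r by rewrite expr2 -[ltRHS]mulr1 ltr_pM2l.
have hk : (2 + k) * r ^+ 2 <= 1 + r ^+ 2 + r * k.
  rewrite -subr_ge0 (_ : _ - _ = 1 - r ^+ 2 + k * (r - r ^+ 2)); last by ring.
  by rewrite addr_ge0 ?mulr_ge0 ?subr_ge0 ?ltW.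
have rk : r ^+ 2 <= k ^+ 2 * (1 + r ^+ 2 + r * k).
  apply: (@le_trans _ _ (k ^+ 2 * ((2 + k) * r ^+ 2))).
    rewrite (_ : k ^+ 2 * _ = k * (k * (2 + k)) * r ^+ 2); last by ring.
    by rewrite ler_peMl ?exprn_ge0 ?(ltW r0) // ltW.
  by rewrite ler_wpM2l // exprn_ge0 // ltW.
rewrite (_ : (r * k) ^+ 2 * _ = r ^+ 2 * (k ^+ 2 * (1 + r ^+ 2 + r * k))).
  2: by ring.
by rewrite [leLHS]expr2 ler_wpM2l // exprn_ge0 // ltW.
Qed.

Lemma window_cr_max (i j : 'I_m) : nat_of_ord j = m.-1 -> i != j -> v i < v j.
Proof.
move=> jE ij; have Cj := window_cr_wrap2 jE; have im := ltn_ord i.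
have {}ij : nat_of_ord i != m.-1 by rewrite -jE.
have [i0|i0] := eqVneq (nat_of_ord i) 0%N.
  exact: lt_trans (window_cr_wrap3 i0) Cj.
have [i1|i1] := eqVneq (nat_of_ord i) 1%N.
  exact: lt_trans (window_cr_wrap4 i1) Cj.
have [i2|i2] := eqVneq (nat_of_ord i) m.-2.
  exact: lt_trans (window_cr_wrap1 i2) Cj.
by rewrite window_cr_regular //; clear -hm im ij i0 i1 i2; lia.
Qed.

End SpiralPolygon.

Lemma det3_cols (R : comNzRingType) (M : 'M[R]_3) :
  det3 (col 0 M) (col 1 M) (col 2%:R M) = \det M.
Proof.
(* Entries indexed by numerals let the lifted indices of the cofactor expansion compute. *)
pose f (i j : nat) := M (inord i) (inord j).
have -> : M = \matrix_(i, j) f i j.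
  by apply/matrixP => i j; rewrite mxE /f !inord_val.
rewrite (expand_det_row _ 0) sum_ord3 /cofactor /det3.
rewrite !(expand_det_row _ 0) !big_ord_recl !big_ord0 /cofactor !det_mx11.
rewrite !mxE /bump /= !modn_small //.
ring.
Qed.

(** * An isomorphism fixes every ray *)

Section FixedRays.
Variables (R : realType) (m : nat) (th1 th2 : R).
Hypotheses (hm : (6 <= m)%N) (h1 : 2 * pi / m%:R < th1 < 2 * pi / m.-1%:R)
  (h2 : 2 * pi / m%:R < th2 < 2 * pi / m.-1%:R).

Variable M : 'M[R]_3.
Hypothesis Mu : M \in unitmx.
Hypothesis MK : [set M *m x | x in K_theta m th2] = K_theta m th1.

Let y1 := @x_theta R m th1.
Let y2 := @x_theta R m th2.
Let m3 : (3 <= m)%N. Proof. by lia. Qed.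

Lemma cone_iso_ray_fixed : exists2 c : 'I_m -> R, forall j, 0 < c j &
  forall j, M *m y2 j = c j *: y1 j.
Proof.
have cy1 := x_theta_convex hm h1; have cy2 := x_theta_convex hm h2.
have [s [c [sinj c0 cE]]] := cone_iso_perm m3 cy1 cy2 Mu MK.
have sd := cone_iso_dihedral m3 cy1 cy2 Mu sinj c0 cE.
exists c => // i; rewrite cE; congr (_ *: y1 _).
(* Cross-ratios ignore the linear map, the scaling of rays and the direction of reading, so [s]
   transports them in both cases of [sd]. *)
have W k : window_cr y1 (s k) = window_cr y2 k.
  transitivity (pencil_cr (y1 (s (ord_pred (ord_pred k)))) (y1 (s (ord_pred k)))
    (y1 (s k)) (y1 (s (ordS k))) (y1 (s (ordS (ordS k))))).
    case: sd => sd.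
      have sp k' : s (ord_pred k') = ord_pred (s k').
        by rewrite -[in RHS](ord_predK k') sd ordSK.
      by rewrite !sd !sp.
    have sp k' : s (ord_pred k') = ordS (s k').
      by rewrite -[in RHS](ord_predK k') sd ord_predK.
    by rewrite !sd !sp pencil_cr_rev.
  rewrite -(@pencil_cr_scale _ (c (ord_pred (ord_pred k))) (c (ord_pred k))
    (c k) (c (ordS k)) (c (ordS (ordS k)))) ?gt_eqF // -!cE.
  by rewrite pencil_cr_mulmx // det3_cols_neq0.
have jm : (m.-1 < m)%N by lia.
pose j := Ordinal jm.
(* The last ray is the strict maximum of the cross-ratio in both cones. *)
have sj : s j = j.
  apply/eqP/negPn/negP => sjj.
  have [t st ts] := injF_bij sinj.
  have lt1 := window_cr_max hm h1 (erefl (nat_of_ord j)) sjj.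
  have tj : t j != j by apply: contra_neq sjj => tj; rewrite -{1}tj ts.
  have := window_cr_max hm h2 (erefl (nat_of_ord j)) tj.
  by rewrite -!W ts => lt2; have := lt_trans lt1 lt2; rewrite ltxx.
have m4 : (4 <= m)%N by lia.
have [wj1 wj2 wj3 wj4] := ord_window_m1 m4 (erefl (nat_of_ord j)).
case: sd => sd.
  have sk (k : nat) (km : (k < m)%N) : s (Ordinal km) = Ordinal km.
    elim: k km => [|k IH] km.
      have -> : Ordinal km = ordS j by apply: ord_inj; rewrite wj3.
      by rewrite sd sj.
    have km' : (k < m)%N by lia.
    have -> : Ordinal km = ordS (Ordinal km').
      by apply: val_inj; rewrite /= modn_small.
    by rewrite sd IH.
  by case: i => k km; exact: sk.
have sp k' : s (ord_pred k') = ordS (s k').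
  by rewrite -[in RHS](ord_predK k') sd ord_predK.
(* These are the rays 1 and [m - 3], which a reflection fixing [j] exchanges. *)
have lt th (h : 2 * pi / m%:R < th < 2 * pi / m.-1%:R) :
    window_cr (@x_theta R m th) (ordS (ordS j)) <
    window_cr (@x_theta R m th) (ord_pred (ord_pred j)).
  rewrite [ltRHS](window_cr_regular hm h); last by rewrite wj1; lia.
  exact: window_cr_wrap4.
have := lt _ h2; rewrite -!W !sd !sp sj => lt2.
by have := lt_trans lt2 (lt _ h1); rewrite ltxx.
Qed.

End FixedRays.

(** * Comparing the recurrences of the two spirals *)

Lemma det3_free (R : fieldType) (u v w : 'cV[R]_3) (a b c a' b' c' : R) :
  det3 u v w != 0 ->
  a *: u - b *: v + c *: w = a' *: u - b' *: v + c' *: w ->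
  [/\ a = a', b = b' & c = c'].
Proof.
move=> D0 e.
have eu := congr1 (fun t => det3 t v w) e.
have ev := congr1 (fun t => det3 u t w) e.
have ew := congr1 (fun t => det3 u v t) e.
have Eu x y z : det3 (x *: u - y *: v + z *: w) v w = x * det3 u v w.
  by rewrite /det3 !mxE; ring.
have Ev x y z : det3 u (x *: u - y *: v + z *: w) w = - y * det3 u v w.
  by rewrite /det3 !mxE; ring.
have Ew x y z : det3 u v (x *: u - y *: v + z *: w) = z * det3 u v w.
  by rewrite /det3 !mxE; ring.
rewrite /= !(Eu, Ev, Ew) in eu ev ew.
split; first exact: (mulIf D0 eu); last exact: (mulIf D0 ew).
by apply/oppr_inj/(mulIf D0 ev).
Qed.

Lemma det3_spiral123_neq0 (R : realType) (r th : R) : 0 < r ->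
  det3 (spiral r th 0) (spiral r th 1) (spiral r th 2) != 0 ->
  det3 (spiral r th 1) (spiral r th 2) (spiral r th 3) != 0.
Proof.
move=> r0 D0; have := det3_spiral_add r th 1 0 1 2; rewrite !add1n => ->.
by rewrite mulf_neq0 // !expf_neq0 // gt_eqF.
Qed.

(* [1] is the only real root of the characteristic polynomial
   [(X - 1) * (X ^ 2 - q * X + rho)] of a spiral, so two such polynomials are
   only rescaled into one another by [t = 1]. *)
Lemma spiral_coef_rescale (R : realFieldType) (q1 q2 rho1 rho2 t : R) :
  q2 ^+ 2 < 4 * rho2 ->
  1 + q2 = t * (1 + q1) -> rho2 + q2 = t ^+ 2 * (rho1 + q1) ->
  rho2 = t ^+ 3 * rho1 -> t = 1.
Proof.
move=> disc ea eb ec.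
(* Up to sign, this is [t ^ 3] times the first characteristic polynomial at [1 / t]; it vanishes
   because the second one vanishes at 1. *)
have /eqP : (t - 1) * (rho1 * t ^+ 2 - q1 * t + 1) = 0.
  have -> : (t - 1) * (rho1 * t ^+ 2 - q1 * t + 1) =
    t ^+ 3 * rho1 - t ^+ 2 * (rho1 + q1) + t * (1 + q1) - 1 by ring.
  by rewrite -ea -eb -ec; ring.
rewrite mulf_eq0 subr_eq0 => /orP[/eqP //|/eqP e0].
(* Otherwise [t] is a root of the second quadratic, whose discriminant is then a square, against
   [disc]. *)
have : q2 ^+ 2 - 4 * rho2 = (t - t * q1 + 1) ^+ 2.
  have -> : rho2 = t * (t * q1 - 1).
    have <- : rho1 * t ^+ 2 = t * q1 - 1 by lra.
    by rewrite ec; ring.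
  have -> : q2 = t * (1 + q1) - 1 by rewrite -ea; ring.
  ring.
move=> h; have : 0 <= q2 ^+ 2 - 4 * rho2 by rewrite h sqr_ge0.
by rewrite subr_ge0 leNgt disc.
Qed.

Section Uniqueness.
Variables (R : realType) (m : nat) (th1 th2 : R).
Hypotheses (hm : (6 <= m)%N) (h1 : 2 * pi / m%:R < th1 < 2 * pi / m.-1%:R)
  (h2 : 2 * pi / m%:R < th2 < 2 * pi / m.-1%:R).

Variable M : 'M[R]_3.
Hypothesis Mu : M \in unitmx.
Hypothesis MK : [set M *m x | x in K_theta m th2] = K_theta m th1.

Let r1 := r_theta m th1.
Let r2 := r_theta m th2.
Let rho1 := r1 ^+ 2.
Let rho2 := r2 ^+ 2.
Let q1 := r1 * (2 * cos th1).
Let q2 := r2 * (2 * cos th2).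

Lemma cone_iso_theta :
  th1 = th2 /\ exists c, forall j, (j < 3)%N ->
    M *m spiral r2 th2 j = c *: spiral r1 th1 j.
Proof.
have [c c0 cE] := cone_iso_ray_fixed hm h1 h2 Mu MK.
have im j : (j < 6)%N -> (j < m)%N by move=> j6; exact: leq_trans hm.
have {cE}cE j (j6 : (j < 6)%N) :
    M *m spiral r2 th2 j = c (Ordinal (im j j6)) *: spiral r1 th1 j.
  exact: (cE (Ordinal (im j j6))).
(* Numeral indices for the scalars; the default 1 is not reached below 6. *)
have {c0 cE}[d d0 dE] : exists2 d : nat -> R, forall j, (j < 6)%N -> 0 < d j &
    forall j, (j < 6)%N -> M *m spiral r2 th2 j = d j *: spiral r1 th1 j.
  exists (fun j => if insub j is Some k then c k else 1) => j j6;
    by rewrite (insubT (fun j => j < m)%N (im j j6)) ?c0 ?cE.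
have r10 : 0 < r1 := (r_thetaP hm h1).1.
have r20 : 0 < r2 := (r_thetaP hm h2).1.
have D0 := lt0r_neq0 (det3_012_gt0 hm h1).
have D1 := det3_spiral123_neq0 r10 D0.
have c1p := cos_theta_gt0 hm h1; have c2p := cos_theta_gt0 hm h2.
have q10 : 0 < q1 by rewrite !mulr_gt0.
have q20 : 0 < q2 by rewrite !mulr_gt0.
have rho10 : 0 < rho1 by rewrite exprn_gt0.
have rho20 : 0 < rho2 by rewrite exprn_gt0.
(* The image of ray [j.+3] computed twice: by the first recurrence after applying [M], and by the
   second before. *)
have step j : (j < 3)%N ->
    (d j.+3 * (1 + q1)) *: spiral r1 th1 j.+2
    - (d j.+3 * (rho1 + q1)) *: spiral r1 th1 j.+1
    + (d j.+3 * rho1) *: spiral r1 th1 j =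
    ((1 + q2) * d j.+2) *: spiral r1 th1 j.+2
    - ((rho2 + q2) * d j.+1) *: spiral r1 th1 j.+1
    + (rho2 * d j) *: spiral r1 th1 j.
  move=> j3; have := dE j.+3 j3.
  have j4 : (j.+2 < 6)%N by exact: ltnW j3.
  have j5 : (j.+1 < 6)%N by apply: ltnW.
  rewrite !spiral_rec -/rho1 -/rho2 -/q1 -/q2 mulmxDr mulmxBr -!scalemxAr.
  rewrite (dE _ j4) (dE _ j5) (dE _ (ltnW j5)) scalerDr scalerBr !scalerA.
  by move=> ->.
have [a0 b0 e0] : [/\ d 3 * (1 + q1) = (1 + q2) * d 2,
    d 3 * (rho1 + q1) = (rho2 + q2) * d 1 & d 3 * rho1 = rho2 * d 0].
  apply: det3_free (step 0%N isT).
  by rewrite det3_rot det3_swapr oppr_eq0 -det3_rot.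
have [a1 b1 e1] : [/\ d 4 * (1 + q1) = (1 + q2) * d 3,
    d 4 * (rho1 + q1) = (rho2 + q2) * d 2 & d 4 * rho1 = rho2 * d 1].
  apply: det3_free (step 1%N isT).
  by rewrite det3_rot det3_swapr oppr_eq0 -det3_rot.
have [p0 p1 p2 p3 p4] : [/\ 0 < d 0, 0 < d 1, 0 < d 2, 0 < d 3 & 0 < d 4].
  by split; apply: d0.
(* The comparisons at indices 0 and 1 make [d] grow by the ratio [t], so the second recurrence is
   the first one rescaled by [t]. *)
pose t := d 3 / d 2.
have ta : 1 + q2 = t * (1 + q1).
  by apply: (mulIf (lt0r_neq0 p2)); rewrite -a0 /t; field; rewrite gt_eqF.
have d4 : d 4 = t * d 3.
  apply: (@mulIf _ (1 + q1)); first by rewrite gt_eqF // addr_gt0.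
  by rewrite a1 ta; ring.
have d3 : d 3 = t * d 2 by rewrite /t; field; rewrite gt_eqF.
have tb : rho2 + q2 = t ^+ 2 * (rho1 + q1).
  by apply: (mulIf (lt0r_neq0 p2)); rewrite -b1 d4 d3; ring.
have t0 : t != 0 by rewrite gt_eqF // divr_gt0.
have d31 : d 3 = t ^+ 2 * d 1.
  apply: (@mulIf _ (rho1 + q1)); first by rewrite gt_eqF // addr_gt0.
  by rewrite b0 tb; ring.
have te : rho2 = t ^+ 3 * rho1.
  by apply: (mulIf (lt0r_neq0 p1)); rewrite -e1 d4 d31; ring.
have t1 : t = 1.
  apply: (spiral_coef_rescale _ ta tb te).
  have s2 : 0 < sin th2 := sin_theta_gt0 hm h2.
  rewrite -subr_gt0 (_ : _ - _ = 4 * r2 ^+ 2 * (1 - cos th2 ^+ 2)); last first.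
    by rewrite /q2 /rho2; ring.
  by rewrite -sin2cos2 !mulr_gt0 ?exprn_gt0.
rewrite t1 ?expr1n !mul1r in ta tb te d3 d31.
have r12 : r2 = r1 by move/eqP: te; rewrite /rho2 /rho1 eqrXn2 ?ltW // => /eqP.
have q12 : q2 = q1 by lra.
split.
  have cc : cos th2 = cos th1.
    by move: q12; rewrite /q2 /q1 r12 => /(mulfI (lt0r_neq0 r10)) ?; lra.
  have itv th : 2 * pi / m%:R < th < 2 * pi / m.-1%:R -> th \in `[0, pi].
    move=> h; rewrite in_itv /= ltW ?(theta_gt0 hm h) //=.
    by have := theta5_lt hm h; have := theta_gt0 hm h; lra.
  by apply: cos_inj; rewrite ?itv.
exists (d 3); case=> [|[|[|]]] // _; rewrite dE //; congr (_ *: _).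
- by apply: (mulfI (lt0r_neq0 rho20)); rewrite -e0 te mulrC.
- by rewrite d31.
- by rewrite d3.
Qed.

End Uniqueness.

(** * From cone isomorphisms to invertible matrices and scalars *)

Lemma scalar_mx_free (R : fieldType) (M : 'M[R]_3) (u v w : 'cV[R]_3) (c : R) :
  det3 u v w != 0 -> M *m u = c *: u -> M *m v = c *: v -> M *m w = c *: w ->
  is_scalar_mx M.
Proof.
move=> D0 Mu Mv Mw; apply/is_scalar_mxP; exists c.
have Mt (t : 'cV_3) : M *m t = c *: t.
  have tE := cramer u v w t; apply: (scalerI D0).
  rewrite scalemxAr tE scalerA mulrC -scalerA tE !mulmxDr -!scalemxAr Mu Mv Mw.
  by rewrite !scalerDr !scalerA ![c * _]mulrC.
apply/matrixP => i j.
have /(congr1 (fun t : 'cV[R]_3 => t i 0)) := Mt (delta_mx j 0).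
by rewrite -colE !mxE andbT mulr_natr.
Qed.

Section Linspan.
Variables (R : realType) (m : nat) (theta : R).
Hypotheses (hm : (6 <= m)%N)
  (htheta : 2 * pi / m%:R < theta < 2 * pi / m.-1%:R).

Lemma spiral_in_K j : (j < m)%N ->
  K_theta m theta (spiral (r_theta m theta) theta j).
Proof.
by move=> jm; exact: (cone_gen_mem (@x_theta R m theta) (Ordinal jm)).
Qed.

Lemma linspan_K v : v \in linspan (K_theta m theta).
Proof.
have [KU _] := linspanP (K_theta m theta).
have D0 := lt0r_neq0 (det3_012_gt0 hm htheta).
have im j : (j < 3)%N -> (j < m)%N.
  by move=> j3; apply: leq_trans hm; apply: leq_trans j3 _.
rewrite -[v]scale1r -(mulVf D0) -scalerA cramer.
by rewrite memvZ // !memvD // memvZ // KU //; apply: spiral_in_K; apply: im.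
Qed.

End Linspan.

(** When the span is the whole space, [vsproj] loses nothing, so the map of spans becomes a matrix
    through its values on the standard basis. *)
Lemma cone_isomorphic_mx (R : realType) (n : nat) (K1 K2 : set 'cV[R]_n) :
  (forall v, v \in linspan K2) -> cone_isomorphic K1 K2 ->
  exists M : 'M[R]_n, [set M *m x | x in K2] = K1.
Proof.
move=> K2T [P _ PK].
pose f v := vsval (P (vsproj (linspan K2) v)).
exists (\matrix_(i, j) f (delta_mx j 0) i 0).
have fE v : (\matrix_(i, j) f (delta_mx j 0) i 0) *m v = f v.
  have -> : f v = \sum_j v j 0 *: f (delta_mx j 0).
    rewrite {1}[v](matrix_sum_delta v) /f.
    rewrite !linear_sum; apply: eq_bigr => j _.
    by rewrite big_ord1 !linearZ.
  apply/colP => i; rewrite !mxE summxE; apply: eq_bigr => j _.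
  by rewrite !mxE mulrC.
rewrite -PK; apply/seteqP; split=> [_ [x Kx <-]|_ [y Ky <-]] /=.
  by rewrite fE; exists (vsproj (linspan K2) x); rewrite //= vsprojK.
by exists (vsval y); rewrite // fE /f vsvalK.
Qed.

(** The image of [M] contains three independent rays, so its determinant is nonzero. *)
Lemma K_theta_mx_unit (R : realType) (m : nat) (th : R) (K : set 'cV[R]_3)
    (M : 'M[R]_3) :
  (6 <= m)%N -> 2 * pi / m%:R < th < 2 * pi / m.-1%:R ->
  [set M *m x | x in K] = K_theta m th -> M \in unitmx.
Proof.
move=> hm h MK; have im j : (j < 3)%N -> (j < m)%N.
  by move=> j3; apply: leq_trans hm; apply: leq_trans j3 _.
have ex j : (j < 3)%N -> exists x, M *m x = spiral (r_theta m th) th j.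
  move=> j3; have := @spiral_in_K _ _ th _ (im _ j3).
  by rewrite -MK => -[x _ <-]; exists x.
have [x0 x0E] := ex 0%N isT; have [x1 x1E] := ex 1%N isT.
have [x2 x2E] := ex 2%N isT.
have := lt0r_neq0 (det3_012_gt0 hm h).
rewrite -x0E -x1E -x2E det3_mulmx det3_cols.
by rewrite mulf_eq0 negb_or => /andP[+ _]; rewrite unitmxE unitfE.
Qed.

Theorem corollary8p7 (R : realType) (m : nat) (hm : (6 <= m)%N) :
  (forall theta : R, 2 * pi / m%:R < theta < 2 * pi / m.-1%:R ->
     forall P : 'M[R]_3, cone_aut (K_theta m theta) P -> is_scalar_mx P) /\
  (forall theta1 theta2 : R,
     2 * pi / m%:R < theta1 < 2 * pi / m.-1%:R ->
     2 * pi / m%:R < theta2 < 2 * pi / m.-1%:R ->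
     theta1 <> theta2 ->
     ~ cone_isomorphic (K_theta m theta1) (K_theta m theta2)).
Proof.
split=> [theta h P [Pu PK]|theta1 theta2 h1 h2 ne iso].
  (* An automorphism is an isomorphism with both angles equal. *)
  have [_ [c cE]] := cone_iso_theta hm h h Pu PK.
  apply: (scalar_mx_free (lt0r_neq0 (det3_012_gt0 hm h))); exact: cE.
have [M MK] := cone_isomorphic_mx (linspan_K hm h2) iso.
by have [] := cone_iso_theta hm h1 h2 (K_theta_mx_unit hm h1 MK) MK.
Qed.
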